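(* Let $\mu\in\mathcal F$ and assume that $J$ is twice differentiable on $(0,\frac12)$. For $\varepsilon,\eta\in(0,1/2)$ with $2\eta\le\varepsilon$, set $$E=E(\varepsilon,\eta)=\left(-\beta_{\frac12+\eta-\varepsilon},\ \beta_{\frac12+\eta+\varepsilon}\right).$$ Then $\mu(E)=p:=\frac12-\eta$, $\lambda(E)=\lambda:=1-\varepsilon$, and, as $\varepsilon,\eta\to0$, $$\delta(E)=2J'\left(\tfrac14\right)\eta+\tfrac14J''\left(\tfrac14\right)\varepsilon^2+o(\eta^2)+o(\varepsilon^2).$$ In particular $\delta(E)\to 0$ while $\lambda(E)\to 1$; and if $J''(1/4)>0$, there are a constant $C\ge1$ and $\varepsilon_0>0$ such that for $0<2\eta\le\varepsilon\le\varepsilon_0$, $$C^{-1}\big[(1-\lambda)^2+(1-2p)\big]\le\delta(E)\le C\big[(1-\lambda)^2+(1-2p)\big].$$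
   Context: $\mathcal F$ is the class of Borel probability measures $\mu$ on $\mathbb R$ having a density $f$ (with respect to Lebesgue measure) that is even, continuous and positive on $\mathbb R$, and such that $\log f$ is strictly convex on $(-\infty,0)$ and on $(0,\infty)$. $F(x)=\mu((-\infty,x])$, with inverse $F^{-1}:(0,1)\to\mathbb R$, $F^{-1}(0)=-\infty$, $F^{-1}(1)=+\infty$. $J(t)=f(F^{-1}(t))$ for $0<t<1$, $J(0)=J(1)=0$ ($J$ is symmetric about $1/2$). The $\mu$-perimeter of a Borel set $E$ is $P(E)=\sum_{x\in\partial^M E}f(x)$, where $\partial^M E$ is the essential boundary; for a bounded open interval $P((a,b))=f(a)+f(b)$. For $q\in[0,2]$ put $\beta_q=-F^{-1}(q/2)$. For a set $E$ with $\mu(E)=p<1/2$, the deficit is $\delta(E)=P(E)-P\big((-\infty,-\beta_p)\cup(\beta_p,+\infty)\big)$ and the asymmetry is $\lambda(E)=\mu\big(E\bigtriangleup((-\infty,-\beta_p)\cup(\beta_p,+\infty))\big)$. *)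

(* Defs.v *)
From HB Require Import structures.
From mathcomp Require Import all_boot all_order all_algebra.
From mathcomp Require Import all_classical all_reals all_analysis.

Set Implicit Arguments.
Unset Strict Implicit.
Unset Printing Implicit Defensive.

Import Order.TTheory GRing.Theory Num.Theory.
Import numFieldNormedType.Exports.

Local Open Scope classical_set_scope.
Local Open Scope ring_scope.

Definition strictly_convex_on (R : realType) (D : set R) (g : R -> R) : Prop :=
  forall x y t : R, D x -> D y -> x != y -> 0 < t < 1 ->
    g (t * x + (1 - t) * y) < t * g x + (1 - t) * g y.

(* mu is in the class F, with density f; the continuous density of mu is
   unique, so the objects defined below from mu and f depend on mu only. *)
Record inF (R : realType) (mu : probability (measurableTypeR R) R)
    (f : R -> R) : Prop := InF {
  inF_density : forall A : set (measurableTypeR R), measurable A ->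
    mu A = (\int[lebesgue_measure]_(x in A) (f x)%:E)%E;
  inF_even : forall x : R, f (- x) = f x;
  inF_continuous : continuous f;
  inF_gt0 : forall x : R, 0 < f x;
  inF_convexl : strictly_convex_on `]-oo, 0%R[ (fun x => ln (f x));
  inF_convexr : strictly_convex_on `]0%R, +oo[ (fun x => ln (f x))
}.

Section Notions.
Variables (R : realType) (mu : probability (measurableTypeR R) R) (f : R -> R).

Definition distF (x : R) : R := fine (mu `]-oo, x]%classic).

(* F^-1 on [0, 1]; for 0 < t < 1 the equation F x = t has exactly one solution
   when mu has a positive density. *)
Definition invF (t : R) : \bar R :=
  if t <= 0 then -oo%E
  else if 1 <= t then +oo%E
  else (xget 0 [set x | distF x = t])%:E.

Definition J (t : R) : R := if 0 < t < 1 then f (fine (invF t)) else 0.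

Definition beta (q : R) : \bar R := (- invF (q / 2))%E.

Definition has_density_at (E : set R) (x d : R) : Prop :=
  (lebesgue_measure (E `&` ball x r) * (lebesgue_measure (ball x r))^-1)%E
    @[r --> 0^'+] --> d%:E.

Definition ess_boundary (E : set R) : set R :=
  [set x | ~ has_density_at E x 0 /\ ~ has_density_at E x 1].

Definition perimeter (E : set R) : \bar R :=
  \esum_(x in ess_boundary E) (f x)%:E.

Definition tails (p : R) : set R :=
  [set x | (x%:E < - beta p)%E] `|` [set x | (beta p < x%:E)%E].

Definition deficit (E : set R) : \bar R :=
  (perimeter E - perimeter (tails (fine (mu E))))%E.

Definition asymmetry (E : set R) : \bar R :=
  mu (E `+` tails (fine (mu E))).

Definition Eset (eps eta : R) : set R :=
  [set x | (- beta (1 / 2 + eta - eps)%R < x%:E < beta (1 / 2 + eta + eps)%R)%E].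

End Notions.

Definition admissible (R : realType) : set (R * R) :=
  [set z | [/\ 0 < z.1 < 1 / 2, 0 < z.2 < 1 / 2 & 2 * z.2 <= z.1]].

(* (eps, eta) tends to (0, 0) among admissible pairs *)
Definition to0 {R : realType} : set_system (R * R) :=
  within (@admissible R) (nbhs ((0, 0) : R * R)).

(* Main.v *)
Require Import Defs.
From HB Require Import structures.
From mathcomp Require Import all_boot all_order all_algebra.
From mathcomp Require Import all_classical all_reals all_analysis.
From mathcomp Require Import measurable_realfun ring lra.

Import Order.TTheory GRing.Theory Num.Theory.
Import numFieldNormedType.Exports.

Local Open Scope classical_set_scope.
Local Open Scope ring_scope.

(* Write g = J. The interval E and the tails have perimeters
   g(1/4 + (eta - eps)/2) + g(1/4 + (eta + eps)/2) and 2 g(1/4 - eta/2), by the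
   symmetry of g about 1/2, so the expansion of the deficit is a second order
   Taylor expansion of g at 1/4. The condition 2 eta <= eps turns the whole
   remainder into o(eps^2), and makes the left half-tail overlap E.
   The two-sided bound needs g'(1/4) > 0: since f is integrable, it takes smaller
   values to the left of any x < 0, so the strict convexity of log f makes f grow
   at least linearly to the right of x, while the distribution function is locally
   Lipschitz. *)

Set Implicit Arguments.
Unset Strict Implicit.
Unset Printing Implicit Defensive.

(** * The distribution function: masses of intervals, monotonicity, continuity, surjectivity onto
    [(0, 1)] *)

Section DistributionFunction.
Context {R : realType} (mu : probability (measurableTypeR R) R) (f : R -> R).
Hypothesis Fmu : inF mu f.

Local Notation F := (distF mu).

Lemma measurable_density (D : set R) : measurable D ->
  measurable_fun D (EFin \o f).
Proof.
move=> mD; apply: measurable_funTS; apply/measurable_EFinP.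
exact: continuous_measurable_fun (inF_continuous Fmu).
Qed.

Lemma mu_setU (A B : set (measurableTypeR R)) : measurable A -> measurable B ->
  A `&` B = set0 -> mu (A `|` B) = (mu A + mu B)%E.
Proof. by move=> mA mB AB; exact: measureU. Qed.

(** The boolean covers open and closed endpoints at once; both have the same mass because [mu] has a
    density with respect to Lebesgue measure. *)
Lemma mu_itvNy (c : bool) (b : R) :
  mu [set` Interval -oo%O (BSide c b)] = (F b)%:E.
Proof.
rewrite /distF fineK ?fin_num_measure//; case: c => //.
rewrite !(inF_density Fmu)//.
by apply: integral_itv_bndo_bndc; exact: measurable_density.
Qed.

Lemma mu_itvy (c : bool) (a : R) :
  mu [set` Interval (BSide c a) +oo%O] = (1 - F a)%:E.
Proof. by rewrite -setCitvl probability_setC// mu_itvNy. Qed.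

Lemma mu_itv (c d : bool) (a b : R) : a < b ->
  mu [set` Interval (BSide c a) (BSide d b)] = (F b - F a)%:E.
Proof.
move=> ab; have cadb : (BSide c a <= BSide d b)%O.
  by case: c d => -[]; rewrite bnd_simp ?ltW.
have := mu_itvNy d b.
rewrite (@itv_bndbnd_setU _ _ -oo%O (BSide c a))//.
rewrite mu_setU//; last first.
  apply/seteqP; split=> z //=; rewrite !itv_boundlr/= => -[zc /andP[cz _]].
  by have := le_trans zc cz; rewrite bnd_simp ltxx.
by rewrite mu_itvNy EFinB => <-; rewrite addeAC subee// add0e.
Qed.

(** The substitution [y -> - y] turns the left tail integral into a right one, and [f] is even. *)
Lemma distFN (x : R) : F (- x) = 1 - F x.
Proof.
apply: EFin_inj; rewrite -(mu_itvNy false) -(mu_itvy true).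
rewrite !(inF_density Fmu)// ge0_integration_by_substitutionNy.
- by apply: eq_integral => y _ /=; rewrite (inF_even Fmu).
- by apply: continuous_subspaceT; exact: (inF_continuous Fmu).
- by move=> y _; rewrite ltW// (inF_gt0 Fmu).
Qed.

Lemma distF0 : F 0 = 1 / 2.
Proof. by have := distFN 0; rewrite oppr0; lra. Qed.

(** Compares the integral of [f] with those of the constants [m] and [M]. The lower bound serves
    strict monotonicity, the upper one local Lipschitz estimates. *)
Lemma distF_bounds (a b m M : R) : a < b -> 0 <= m ->
  (forall x, a <= x <= b -> m <= f x <= M) ->
  m * (b - a) <= F b - F a <= M * (b - a).
Proof.
move=> ab m0 mfM.
have M0 : 0 <= M.
  by have /andP[ma aM] := mfM a ltac:(lra); rewrite (le_trans m0)// (le_trans ma).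
have lab : lebesgue_measure (`[a, b]%classic : set R) = (b - a)%:E.
  by rewrite lebesgue_measure_itv/= lte_fin ab.
rewrite -!lee_fin -(mu_itv true false)// (inF_density Fmu)//.
rewrite !EFinM -lab -!integral_cst//.
by apply/andP; split; apply: ge0_le_integral => //;
  (try exact: measurable_density); rewrite /= => x; rewrite in_itv/= => /mfM/andP[mf fM];
  rewrite ?lee_fin// ltW// (inF_gt0 Fmu).
Qed.

Lemma distF_lt (a b : R) : a < b -> F a < F b.
Proof.
move=> ab.
have [c _ cmin] := EVT_min (ltW ab) (continuous_subspaceT (inF_continuous Fmu)).
have [d _ dmax] := EVT_max (ltW ab) (continuous_subspaceT (inF_continuous Fmu)).
have /andP[+ _] : f c * (b - a) <= F b - F a <= f d * (b - a).
  apply: distF_bounds => //; first by rewrite ltW// (inF_gt0 Fmu).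
  by move=> x xab; rewrite cmin ?dmax// in_itv/=.
by have := mulr_gt0 (inF_gt0 Fmu c) (_ : 0 < b - a); lra.
Qed.

Lemma distF_ltE (a b : R) : (F a < F b) = (a < b).
Proof. by have := le_mono distF_lt; move/leW_mono; apply. Qed.

Lemma distF_inj : injective F.
Proof. exact: inc_inj (le_mono distF_lt). Qed.

(** On [[x - 1, x + 1]] the maximum of [f] is a Lipschitz constant for [F]. *)
Lemma distF_continuous : continuous F.
Proof.
move=> x.
have x11 : x - 1 <= x + 1 by lra.
have [d _ dmax] := EVT_max x11 (continuous_subspaceT (inF_continuous Fmu)).
have lip a b : x - 1 <= a -> b <= x + 1 -> a < b -> F b - F a <= f d * (b - a).
  move=> xa bx ab.
  have /andP[_ //] : 0 * (b - a) <= F b - F a <= f d * (b - a).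
  apply: distF_bounds => // y yab.
  by rewrite ltW ?(inF_gt0 Fmu)//= dmax// in_itv/=; lra.
have d0 := inF_gt0 Fmu d.
apply/cvgrPdist_le => e e0; near=> y.
have xy1 : `|x - y| <= 1 by near: y; exact: cvgr_dist_le.
have xye : `|x - y| <= e / f d.
  by near: y; apply: cvgr_dist_le => //; rewrite divr_gt0.
have le_e : f d * `|x - y| <= e by rewrite mulrC -ler_pdivlMr.
move: xy1; rewrite ler_norml => xy1.
have [xy|yx|->] := ltgtP x y; last by rewrite subrr normr0 ltW.
- have := lip x y ltac:(lra) ltac:(lra) xy; have := distF_lt xy.
  by move=> Fxy; move: le_e; rewrite !ltr0_norm ?subr_lt0//; lra.
- have := lip y x ltac:(lra) ltac:(lra) yx; have := distF_lt yx.
  by move=> Fyx; move: le_e; rewrite !gtr0_norm ?subr_gt0//; lra.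
Unshelve. all: by end_near. Qed.

(** The identity seen as a random variable: its cdf is [F], which gives access to the limits of a
    cdf at both infinities. *)
Let X : measurableTypeR R -> R := idfun.

#[local] HB.instance Definition _ :=
  @isMeasurableFun.Build _ _ _ _ X (@measurable_id _ _ setT).

(** [F] tends to 0 and 1 at the two infinities, hence passes below and above [t]; the intermediate
    value theorem does the rest. *)
Lemma distF_surj (t : R) : 0 < t < 1 -> exists x, F x = t.
Proof.
move=> /andP[t0 t1].
have cdfE : cdf (X : {RV mu >-> R}) = EFin \o F.
  by apply/funext => x /=; rewrite -(mu_itvNy false).
have FNy : F x @[x --> -oo] --> (0 : R).
  by have := cvg_cdfNy0 (X : {RV mu >-> R}); rewrite cdfE => /fine_cvg.
have Fy : F x @[x --> +oo] --> (1 : R).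
  by have := cvg_cdfy1 (X : {RV mu >-> R}); rewrite cdfE => /fine_cvg.
have [a Fa] := @filter_ex _ _ proper_ninfty_nbhs _ (cvgr_lt _ FNy _ t0).
have [b Fb] := @filter_ex _ _ proper_pinfty_nbhs _ (cvgr_gt _ Fy _ t1).
have ab : a <= b by rewrite ltW// -distF_ltE (lt_trans Fa).
have Ftab : Num.min (F a) (F b) <= t <= Num.max (F a) (F b).
  by rewrite ge_min le_max (ltW Fa) (ltW Fb) orbT.
have [c _ Fc] := IVT ab (continuous_subspaceT distF_continuous) Ftab.
by exists c.
Qed.
End DistributionFunction.

(** * Taylor expansions with Peano remainder, of orders one and two *)

Lemma derivable_peano1 {R : realType} (g : R -> R) (t : R) : derivable g t 1 ->
  forall e : R, 0 < e -> exists2 d : R, 0 < d & forall h, `|h| < d ->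
    `|g (t + h) - g t - derive1 g t * h| <= e * `|h|.
Proof.
move=> dg e e0; rewrite derive1E.
have /cvgrPdist_le/(_ e e0) := dg.
rewrite -/(derive g t 1) near_withinE => /nbhs_ballP[d /= d0 dP].
exists d => // h hd.
have [->|h0] := eqVneq h 0; first by rewrite addr0 subrr mulr0 subrr normr0 mulr0.
have := dP h; rewrite /ball/= sub0r normrN => /(_ hd h0).
rewrite /= /shift/= /GRing.scale/= mulr1 (addrC h) => qh.
set D := 'D_1 g t in qh *.
have -> : g (t + h) - g t - D * h = - (D - h^-1 * (g (t + h) - g t)) * h by field.
by rewrite normrM normrN ler_wpM2r.
Qed.

(** The second derivative is only assumed to exist at [t], so the order one expansion is applied to
    [g'] and then integrated by the mean value theorem. *)
Lemma derivable_peano2 {R : realType} (g : R -> R) (t r : R) : 0 < r ->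
  (forall s, `|s - t| < r -> derivable g s 1) -> derivable (derive1 g) t 1 ->
  forall e : R, 0 < e -> exists2 d : R, 0 < d & forall h, `|h| < d ->
    `|g (t + h) - g t - derive1 g t * h - derive1n 2 g t / 2 * h ^+ 2|
      <= e * h ^+ 2.
Proof.
move=> r0 dg d2g e e0.
have [d d0 dP] := derivable_peano1 d2g e0.
exists (Num.min d r) => [|h]; first by rewrite lt_min d0.
rewrite lt_min => /andP[hd hr].
(* Up to the constant [g t], [psi] is the Taylor remainder; its derivative [dpsi] is the order one
   remainder of [g'], of size [e * |s - t|]. The mean value theorem supplies the second factor
   [h]. *)
pose psi s := g s - derive1 g t * (s - t) - derive1n 2 g t / 2 * (s - t) ^+ 2.
pose dpsi s := derive1 g s - derive1 g t - derive1n 2 g t * (s - t).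
have dpsiP s : `|s - t| < r -> is_derive s 1 psi (dpsi s).
  move=> sr; have gs : is_derive s (1 : R) g (derive1 g s).
    by rewrite derive1E; apply/derivableP/dg.
  rewrite /psi; apply: is_derive_eq.
  by rewrite /dpsi /GRing.scale/=; field.
have psi_cont (i : interval R) : (forall s, s \in i -> `|s - t| < r) ->
    {within [set` i], continuous psi}.
  by move=> ir; apply: derivable_within_continuous => s /ir/dpsiP[].
have dpsi_le s : `|s - t| <= `|h| -> `|dpsi s| <= e * `|h|.
  move=> sh; have := dP (s - t) (le_lt_trans sh hd).
  rewrite subrKC => /le_trans; apply.
  by rewrite ler_wpM2l// ltW.
suff [c ch Ec] : exists2 c, `|c - t| <= `|h| & psi (t + h) - psi t = dpsi c * h.
  have -> : g (t + h) - g t - derive1 g t * h - derive1n 2 g t / 2 * h ^+ 2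
    = psi (t + h) - psi t by rewrite /psi; field.
  by rewrite Ec normrM -(real_normK (num_real h)) expr2 mulrA ler_wpM2r// dpsi_le.
have [h0|h0] := leP 0 h.
- have hE : `|h| = h by rewrite ger0_norm.
  have itvr s : s \in `[t, t + h] -> `|s - t| <= `|h|.
    by rewrite in_itv/= hE => sth; rewrite ler_norml; lra.
  have [c /itvr ch Ec] : exists2 c, c \in `[t, t + h] &
      psi (t + h) - psi t = dpsi c * (t + h - t).
    apply: MVT_segment => [|s /subset_itv_oo_cc/itvr sh|]; first by lra.
    - by apply: dpsiP; exact: le_lt_trans hr.
    - by apply: psi_cont => s /itvr sh; exact: le_lt_trans hr.
  by exists c => //; rewrite Ec; congr (_ * _); ring.
- have hE : `|h| = - h by rewrite ltr0_norm.
  have itvr s : s \in `[t + h, t] -> `|s - t| <= `|h|.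
    by rewrite in_itv/= hE => sth; rewrite ler_norml; lra.
  have [c /itvr ch Ec] : exists2 c, c \in `[t + h, t] &
      psi t - psi (t + h) = dpsi c * (t - (t + h)).
    apply: MVT_segment => [|s /subset_itv_oo_cc/itvr sh|]; first by lra.
    - by apply: dpsiP; exact: le_lt_trans hr.
    - by apply: psi_cont => s /itvr sh; exact: le_lt_trans hr.
  by exists c => //; rewrite -opprB Ec; ring.
Qed.

(** * The profile [J]: symmetry about 1/2 and positivity of its derivative on [(0, 1/2)] *)

Section DensityProfile.
Context {R : realType} (mu : probability (measurableTypeR R) R) (f : R -> R).
Hypothesis Fmu : inF mu f.

Local Notation F := (distF mu).

Lemma distF_gt0 (x : R) : 0 < F x.
Proof.
apply: le_lt_trans (distF_lt Fmu (_ : x - 1 < x)); last by lra.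
by rewrite fine_ge0.
Qed.

Lemma distF_lt1 (x : R) : F x < 1.
Proof. by have := distF_gt0 (- x); rewrite (distFN Fmu); lra. Qed.

(** As [F x] lies strictly between 0 and 1, the infinite branches are excluded, and injectivity
    identifies the chosen preimage. *)
Lemma invF_distF (x : R) : Defs.invF mu (F x) = x%:E.
Proof.
rewrite /Defs.invF leNgt distF_gt0/= leNgt distF_lt1/=; congr EFin.
by apply: xget_unique => // y; exact: (distF_inj Fmu).
Qed.

Lemma invF_fin (t : R) : 0 < t < 1 -> exists2 x, F x = t & Defs.invF mu t = x%:E.
Proof.
by move=> /(distF_surj Fmu)[x <-]; exists x => //; exact: invF_distF.
Qed.

Lemma J_distF (x : R) : J mu f (F x) = f x.
Proof. by rewrite /J distF_gt0 distF_lt1 invF_distF. Qed.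

Lemma J1B (t : R) : J mu f (1 - t) = J mu f t.
Proof.
have [t01|t01] := boolP (0 < t < 1).
  have [x <- _] := invF_fin t01.
  by rewrite -(distFN Fmu) !J_distF (inF_even Fmu).
rewrite /J (negbTE t01) ifN//; apply: contra t01; lra.
Qed.

(* Otherwise f would be at least f x on (-oo, x), which would have infinite mass. *)
Lemma density_lt_left (x : R) : exists2 y, y < x & f y < f x.
Proof.
apply: contrapT => noy.
have fge y : y < x -> f x <= f y.
  by move=> yx; rewrite leNgt; apply/negP => fyx; apply: noy; exists y.
have fx0 := inF_gt0 Fmu x.
(* Over this length a density at least [f x] would carry mass 2, more than the total mass. *)
pose n := 2 / f x; have n0 : 0 < n by rewrite divr_gt0.
have xn : x - n < x by lra.
have [d _ dmax] := EVT_max (ltW xn) (continuous_subspaceT (inF_continuous Fmu)).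
have /andP[+ _] : f x * (x - (x - n)) <= F x - F (x - n) <= f d * (x - (x - n)).
  apply: (distF_bounds Fmu) => // [|y yx]; first exact: ltW.
  rewrite dmax ?in_itv//= andbT; case/andP: yx => _.
  by rewrite le_eqVlt => /predU1P[->//|/fge].
have -> : f x * (x - (x - n)) = 2 by rewrite /n; field; rewrite gt_eqF.
by have := distF_lt1 x; have := distF_gt0 (x - n); lra.
Qed.

(** With [f y < f x] for some [y < x], the chord of [log f] over [[y, x]] has slope [k > 0]. By
    convexity later chords from [x] are at least as steep, and [exp u >= 1 + u] transfers the linear
    growth from [log f] to [f]. *)
Lemma density_growth (x : R) : x < 0 -> exists2 c, 0 < c &
  forall z, x < z < 0 -> c * (z - x) <= f z - f x.
Proof.
move=> x0; have [y yx fyx] := density_lt_left x.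
have f0 := inF_gt0 Fmu.
pose g s := ln (f s).
have gyx : g y < g x by rewrite ltr_ln ?posrE.
pose k := (g x - g y) / (x - y).
have k0 : 0 < k by rewrite divr_gt0 ?subr_gt0.
exists (f x * k) => [|z /andP[xz z0]]; first by rewrite mulr_gt0.
have gz : k * (z - x) <= g z - g x.
  (* The weight that writes [x] as the convex combination [t * y + (1 - t) * z]. *)
  pose t := (z - x) / (z - y).
  have zy : 0 < z - y by lra.
  have t01 : 0 < t < 1.
    apply/andP; split; first by rewrite divr_gt0// subr_gt0.
    by rewrite ltr_pdivrMr// mul1r; lra.
  have yz : y != z by rewrite lt_eqF//; lra.
  have yl : `]-oo, 0%R[%classic y by rewrite /= in_itv/=; lra.
  have zl : `]-oo, 0%R[%classic z by rewrite /= in_itv/=.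
  have := inF_convexl Fmu yl zl yz t01.
  have -> : t * y + (1 - t) * z = x by rewrite /t; field; lra.
  rewrite -/(g x) -/(g y) -/(g z) => gc.
  rewrite /k mulrAC ler_pdivrMr ?subr_gt0//.
  have : 0 < (z - y) * (t * g y + (1 - t) * g z - g x).
    by rewrite mulr_gt0// subr_gt0.
  have -> : (z - y) * (t * g y + (1 - t) * g z - g x)
    = (g z - g x) * (x - y) - (g x - g y) * (z - x) by rewrite /t; field; lra.
  by lra.
have fzE : f z = f x * expR (g z - g x).
  by rewrite expRB /g !lnK ?posrE// mulrC divfK// gt_eqF.
have := expR_ge1Dx (g z - g x); rewrite fzE => ge1.
have : f x * (1 + k * (z - x)) <= f x * expR (g z - g x).
  by rewrite ler_pM2l//; lra.
by lra.
Qed.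

(** With [t = F x], [x < 0], [f] grows at rate at least [c] to the right of [x], while [F] grows at
    rate at most [f m], the maximum of [f] on [[x, 0]]. Hence [J] grows at rate at least
    [c / f m]. *)
Lemma J_derive_gt0 (t : R) : 0 < t < 1 / 2 -> derivable (J mu f) t 1 ->
  0 < derive1 (J mu f) t.
Proof.
move=> t0 dJ; have /invF_fin[x Fx _] : 0 < t < 1 by lra.
have x0 : x < 0 by rewrite -(distF_ltE Fmu) Fx (distF0 Fmu); lra.
have [c c0 growth] := density_growth x0.
have [m _ mmax] := EVT_max (ltW x0) (continuous_subspaceT (inF_continuous Fmu)).
have fm0 := inF_gt0 Fmu m.
have Jgrowth s : t < s < 1 / 2 -> c / f m * (s - t) <= J mu f s - J mu f t.
  move=> ts; have /invF_fin[z Fz _] : 0 < s < 1 by lra.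
  have xz : x < z by rewrite -(distF_ltE Fmu) Fx Fz; lra.
  have z0 : z < 0 by rewrite -(distF_ltE Fmu) Fz (distF0 Fmu); lra.
  rewrite -Fx -Fz !J_distF; apply: le_trans (growth z _); last by rewrite xz.
  rewrite mulrAC ler_pdivrMr// -mulrA ler_pM2l//.
  have /andP[_] : 0 * (z - x) <= F z - F x <= f m * (z - x).
    apply: (distF_bounds Fmu) => // y yxz.
    by rewrite ltW ?(inF_gt0 Fmu)//= mmax// in_itv/=; lra.
  by rewrite mulrC.
rewrite ltNge; apply/negP => J'0.
(* Half the growth rate as tolerance: if [J' t <= 0], the increment over [h] is at most half of what
   the growth forces. *)
have k0 : 0 < c / f m / 2 by rewrite !divr_gt0.
have [d d0 dP] := derivable_peano1 dJ k0.
(* Small enough for the expansion, and keeping [t + h] below 1/2 where the growth bound holds. *)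
pose h := Num.min (d / 2) ((1 / 2 - t) / 2).
have [h0 hd ht] : [/\ 0 < h, h < d & h < 1 / 2 - t].
  by rewrite lt_min !gt_min; split; [|apply/orP; left|apply/orP; right]; lra.
have hE : `|h| = h by rewrite gtr0_norm.
have := dP h; rewrite hE => /(_ hd); rewrite ler_norml => /andP[_ le1].
have := Jgrowth (t + h); rewrite addrAC subrr add0r => /(_ ltac:(lra)) le2.
have : derive1 (J mu f) t * h <= 0 by rewrite mulr_le0_ge0// ltW.
have : 0 < c / f m * h by rewrite mulr_gt0// divr_gt0.
by lra.
Qed.

End DensityProfile.

(** * Essential boundaries and perimeters of an interval and of a pair of half-lines *)

Section EssentialBoundary.
Context {R : realType}.
Implicit Types (E : set R) (x d e : R).

Lemma has_density_near E x d e : 0 < e ->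
  (forall r, 0 < r < e -> lebesgue_measure (E `&` ball x r) = (d * (r *+ 2))%:E) ->
  has_density_at E x d.
Proof.
move=> e0 mE; apply: cvg_near_cst; near=> r.
have r0 : 0 < r by near: r; exact: nbhs_right_gt.
have re : r < e by near: r; exact: nbhs_right_lt.
rewrite mE ?r0// lebesgue_measure_ball ?ltW// inver mulrn_eq0/= gt_eqF//.
by rewrite -EFinM mulfK// mulrn_eq0/= gt_eqF.
Unshelve. all: by end_near. Qed.

Lemma has_density_unique E x d e :
  has_density_at E x d -> has_density_at E x e -> d = e.
Proof. by move=> /(cvg_unique _) /[apply] => /(_ (@ereal_hausdorff _))[]. Qed.

Lemma has_density_in E x e : 0 < e -> ball x e `<=` E -> has_density_at E x 1.
Proof.
move=> e0 xeE; apply: (has_density_near e0) => r /andP[r0 re].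
rewrite setIidr ?lebesgue_measure_ball ?mul1r ?ltW//.
by apply: subset_trans xeE; apply: le_ball; exact: ltW.
Qed.

Lemma has_density_out E x e : 0 < e -> E `&` ball x e = set0 ->
  has_density_at E x 0.
Proof.
move=> e0 Exe; apply: (has_density_near e0) => r /andP[r0 re].
suff -> : E `&` ball x r = set0 by rewrite measure0 mul0r.
rewrite -subset0 -[X in _ `<=` X]Exe; apply: setIS; apply: le_ball; exact: ltW.
Qed.

(** Near [x] the set is a half-line ending at [x], so its density there is 1/2, which by uniqueness
    of limits is neither 0 nor 1. *)
Lemma ess_boundary_left E x e : 0 < e ->
  E `&` ball x e = `]-oo, x[ `&` ball x e -> ess_boundary E x.
Proof.
move=> e0 Exe; have : has_density_at E x (1 / 2).
  apply: (has_density_near e0) => r /andP[r0 re].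
  have -> : E `&` ball x r = `]x - r, x[%classic.
    rewrite -(setIidr (le_ball (ltW re))) setIA Exe -setIA (setIidr (le_ball (ltW re))).
    by apply/seteqP; split=> y /=; rewrite ball_itv/= !in_itv/=; lra.
  by rewrite lebesgue_measure_itv/= lte_fin ifT; [congr EFin; field|lra].
by move=> dE; split=> /(has_density_unique dE); lra.
Qed.

Lemma ess_boundary_right E x e : 0 < e ->
  E `&` ball x e = `]x, +oo[ `&` ball x e -> ess_boundary E x.
Proof.
move=> e0 Exe; have : has_density_at E x (1 / 2).
  apply: (has_density_near e0) => r /andP[r0 re].
  have -> : E `&` ball x r = `]x, x + r[%classic.
    rewrite -(setIidr (le_ball (ltW re))) setIA Exe -setIA (setIidr (le_ball (ltW re))).
    by apply/seteqP; split=> y /=; rewrite ball_itv/= !in_itv/=; lra.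
  by rewrite lebesgue_measure_itv/= lte_fin ifT; [congr EFin; field|lra].
by move=> dE; split=> /(has_density_unique dE); lra.
Qed.

(** Points away from the two endpoints have a whole ball inside or outside the set, hence density 1
    or 0. *)
Lemma ess_boundary_itv (a b : R) : a < b ->
  ess_boundary `]a, b[ = [set a; b].
Proof.
move=> ab; apply/seteqP; split=> [x [x0 x1]|x [->|->]].
- apply: contrapT => /not_orP[/eqP xa /eqP xb].
  have [ax|xlta|] := ltgtP a x; last by move=> ax; rewrite ax eqxx in xa.
    have [bx|xltb|] := ltgtP b x; last by move=> bx; rewrite bx eqxx in xb.
      apply: x0; apply: (@has_density_out _ _ (x - b)); first by lra.
      by rewrite -subset0 => y /=; rewrite ball_itv/= !in_itv/=; lra.
    apply: x1; apply: (@has_density_in _ _ (Num.min (x - a) (b - x))).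
      by rewrite lt_min; lra.
    move=> y; rewrite ball_itv/= !in_itv/=.
    by case: (leP (x - a) (b - x)); lra.
  apply: x0; apply: (@has_density_out _ _ (a - x)); first by lra.
  by rewrite -subset0 => y /=; rewrite ball_itv/= !in_itv/=; lra.
- apply: (@ess_boundary_right _ _ (b - a)); first by lra.
  by apply/seteqP; split=> y /=; rewrite ball_itv/= !in_itv/= andbT; lra.
- apply: (@ess_boundary_left _ _ (b - a)); first by lra.
  by apply/seteqP; split=> y /=; rewrite ball_itv/= !in_itv/=; lra.
Qed.

Lemma ess_boundary_itvC (a b : R) : a < b ->
  ess_boundary (`]-oo, a[ `|` `]b, +oo[) = [set a; b].
Proof.
move=> ab; apply/seteqP; split=> [x [x0 x1]|x [->|->]].
- apply: contrapT => /not_orP[/eqP xa /eqP xb].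
  have [ax|xlta|] := ltgtP a x; last by move=> ax; rewrite ax eqxx in xa.
    have [bx|xltb|] := ltgtP b x; last by move=> bx; rewrite bx eqxx in xb.
      apply: x1; apply: (@has_density_in _ _ (x - b)); first by lra.
      by move=> y; rewrite ball_itv/= !in_itv/= !andbT => yx; right; lra.
    apply: x0; apply: (@has_density_out _ _ (Num.min (x - a) (b - x))).
      by rewrite lt_min; lra.
    rewrite -subset0 => y /=; rewrite ball_itv/= !in_itv/= !andbT.
    by case: (leP (x - a) (b - x)) => ? [[?|?]]; lra.
  apply: x1; apply: (@has_density_in _ _ (a - x)); first by lra.
  by move=> y; rewrite ball_itv/= !in_itv/= !andbT => yx; left; lra.
- apply: (@ess_boundary_left _ _ (b - a)); first by lra.
  apply/seteqP; split=> y /=; rewrite ball_itv/= !in_itv/= !andbT.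
    by case=> -[?|?]; lra.
  by case=> ? ?; split => //; left.
- apply: (@ess_boundary_right _ _ (b - a)); first by lra.
  apply/seteqP; split=> y /=; rewrite ball_itv/= !in_itv/= !andbT.
    by case=> -[?|?]; lra.
  by case=> ? ?; split => //; right.
Qed.

(** The strict inequality [a < b] keeps the two boundary points distinct, so that both terms are
    counted. *)
Lemma perimeter_set2 (f : R -> R) (E : set R) (a b : R) :
  (forall x, 0 <= f x) -> a < b -> ess_boundary E = [set a; b] ->
  perimeter f E = (f a + f b)%:E.
Proof.
move=> f0 ab; rewrite /perimeter => ->.
rewrite esum_fset//; last by move=> x _; rewrite lee_fin.
rewrite fsbigU//; last first.
  by move=> x [/= -> ba]; move: ab; rewrite ba ltxx.
by rewrite !fsbig_set1.
Qed.

End EssentialBoundary.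

(** * The deficit in terms of the profile, and its second order expansion at 1/4 *)

Definition deficit_profile {R : realType} (g : R -> R) (z : R * R) : R :=
  g (1 / 4 + (z.2 - z.1) / 2) + g (1 / 4 + (z.2 + z.1) / 2)
  - 2 * g (1 / 4 - z.2 / 2).

Definition deficit_remainder {R : realType} (g : R -> R) (z : R * R) : R :=
  deficit_profile g z
  - (2 * derive1 g (1 / 4) * z.2 + 1 / 4 * derive1n 2 g (1 / 4) * z.1 ^+ 2).

(* The three increments (eta - eps)/2, (eta + eps)/2, -eta/2 at 1/4 contribute
   exactly 2 g' eta + g'' eps^2 / 4 to second order: the eta^2 terms cancel. *)
Lemma deficit_remainder_le {R : realType} (g : R -> R) :
  (forall t : R, 0 < t < 1 / 2 -> derivable g t 1) ->
  derivable (derive1 g) (1 / 4) 1 ->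
  forall c : R, 0 < c -> exists2 d : R, 0 < d & forall z,
    admissible z -> z.1 < d -> `|deficit_remainder g z| <= c * z.1 ^+ 2.
Proof.
move=> dg d2g c c0.
have r0 : 0 < 1 / 4 :> R by lra.
have dg4 s : `|s - 1 / 4| < 1 / 4 -> derivable g s 1.
  by rewrite ltr_norml => s4; apply: dg; lra.
have c40 : 0 < c / 4 by rewrite divr_gt0.
have [d d0 dP] := derivable_peano2 r0 dg4 d2g c40.
exists d => // -[eps eta] [/= eps01 eta01 eta_eps] epsd.
pose u h := g (1 / 4 + h) - g (1 / 4) - derive1 g (1 / 4) * h
  - derive1n 2 g (1 / 4) / 2 * h ^+ 2.
have uP h : `|h| <= eps -> `|u h| <= c / 4 * eps ^+ 2.
  move=> heps; apply: le_trans (dP _ (le_lt_trans heps epsd)) _.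
  by rewrite ler_pM2l ?divr_gt0// -(real_normK (num_real h)) lerXn2r ?nnegrE//; lra.
have -> : deficit_remainder g (eps, eta) =
    u ((eta - eps) / 2) + u ((eta + eps) / 2) - 2 * u (- (eta / 2)).
  by rewrite /deficit_remainder /deficit_profile /u/=; field.
have := uP ((eta - eps) / 2); rewrite !ler_norml => /(_ ltac:(lra)) u1.
have := uP ((eta + eps) / 2); rewrite !ler_norml => /(_ ltac:(lra)) u2.
have := uP (- (eta / 2)); rewrite !ler_norml => /(_ ltac:(lra)) u3.
by lra.
Qed.

(** * Mass, perimeter, deficit and asymmetry of [E(eps, eta)] *)

Section Profile.
Context {R : realType} (mu : probability (measurableTypeR R) R) (f : R -> R).
Hypothesis Fmu : inF mu f.

Local Notation F := (distF mu).
Local Notation J := (J mu f).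

Lemma tailsE (p x : R) : F x = p / 2 ->
  tails mu p = `]-oo, x[ `|` `]- x, +oo[.
Proof.
move=> Fx; rewrite /tails /beta -Fx (invF_distF Fmu) oppeK.
by apply/seteqP; split=> y /=; rewrite !in_itv/= andbT !lte_fin.
Qed.

Lemma perimeter_tails (p : R) : 0 < p < 1 ->
  perimeter f (tails mu p) = (2 * J (p / 2))%:E.
Proof.
move=> p01; have /(invF_fin Fmu)[x Fx _] : 0 < p / 2 < 1 by lra.
have x0 : x < 0 by rewrite -(distF_ltE Fmu) (distF0 Fmu) Fx; lra.
have xNx : x < - x by lra.
rewrite (tailsE Fx) (perimeter_set2 _ xNx (ess_boundary_itvC xNx)); last first.
  by move=> y; rewrite ltW// (inF_gt0 Fmu).
by rewrite -Fx (J_distF Fmu) (inF_even Fmu); congr EFin; ring.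
Qed.

Lemma Eset_itv (eps eta : R) : admissible (eps, eta) -> exists a b, [/\ F a = 1 / 4 + (eta - eps) / 2,
  F b = 1 - (1 / 4 + (eta + eps) / 2), a < b & Eset mu eps eta = `]a, b[%classic].
Proof.
move=> -[/= eps01 eta01 eta_eps].
have /(invF_fin Fmu)[a Fa _] : 0 < 1 / 4 + (eta - eps) / 2 < 1 by lra.
have /(invF_fin Fmu)[b Fb _] : 0 < 1 - (1 / 4 + (eta + eps) / 2) < 1 by lra.
exists a, b; split => //; first by rewrite -(distF_ltE Fmu) Fa Fb; lra.
rewrite /Eset /beta.
have -> : (1 / 2 + eta - eps) / 2 = F a by rewrite Fa; field.
have -> : (1 / 2 + eta + eps) / 2 = F (- b) by rewrite (distFN Fmu) Fb; field.
rewrite !(invF_distF Fmu) oppeK -EFinN opprK.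
by apply/seteqP; split=> y /=; rewrite in_itv/= !lte_fin.
Qed.

Lemma mu_Eset (eps eta : R) : admissible (eps, eta) ->
  mu (Eset mu eps eta) = (1 / 2 - eta)%:E.
Proof.
move=> /Eset_itv[a [b [Fa Fb ab ->]]].
by rewrite (mu_itv Fmu)// Fa Fb; congr EFin; field.
Qed.

(** The right endpoint sits at a level near 3/4; the symmetry of [J] about 1/2 brings it back near
    1/4. *)
Lemma perimeter_Eset (eps eta : R) : admissible (eps, eta) ->
  perimeter f (Eset mu eps eta) =
  (J (1 / 4 + (eta - eps) / 2) + J (1 / 4 + (eta + eps) / 2))%:E.
Proof.
move=> /Eset_itv[a [b [Fa Fb ab ->]]].
rewrite (perimeter_set2 _ ab (ess_boundary_itv ab)); last first.
  by move=> y; rewrite ltW// (inF_gt0 Fmu).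
by rewrite -Fa -(J1B Fmu (_ + (eta + eps) / 2)) -Fb !(J_distF Fmu).
Qed.

Lemma deficit_Eset (eps eta : R) : admissible (eps, eta) ->
 
  deficit mu f (Eset mu eps eta) = (deficit_profile J (eps, eta))%:E.
Proof.
move=> adm; rewrite /deficit mu_Eset// perimeter_Eset//= perimeter_tails.
  by rewrite -EFinB (_ : (1 / 2 - eta) / 2 = 1 / 4 - eta / 2)//; field.
by case: adm => /=; lra.
Qed.

(** With tails ending at [c] and starting at [- c], one has [a <= c < b < - c]. The symmetric
    difference is made of a half-line up to [a], an interval from [c] to [b], and the right tail.
    The mass of the right tail is [F c], so the total is [F a + F b = 1 - eps]. *)
Lemma asymmetry_Eset (eps eta : R) : admissible (eps, eta) ->
  asymmetry mu (Eset mu eps eta) = (1 - eps)%:E.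
Proof.
move=> adm; rewrite /asymmetry mu_Eset//=.
have [a [b [Fa Fb ab ->]]] := Eset_itv adm.
case: adm => /= eps01 eta01 eta_eps.
have /(invF_fin Fmu)[c Fc _] : 0 < (1 / 2 - eta) / 2 < 1 by lra.
have FNc : F (- c) = 1 - (1 / 2 - eta) / 2 by rewrite (distFN Fmu) Fc.
(* This inequality is equivalent to [2 * eta <= eps]. *)
have ac : a <= c by rewrite leNgt -(distF_ltE Fmu) Fa Fc; lra.
have cb : c < b by rewrite -(distF_ltE Fmu) Fb Fc; lra.
have bc : b < - c by rewrite -(distF_ltE Fmu) Fb FNc; lra.
(* At the border case a = c the common endpoint belongs to neither set. *)
pose s := a == c.
have -> : `]a, b[ `+` tails mu (1 / 2 - eta) =
    ([set` Interval -oo%O (BSide s a)] `|` [set` Interval (BSide (~~ s) c) (BLeft b)])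
    `|` `]- c, +oo[.
  rewrite (tailsE Fc) /s; move: ac cb bc; rewrite le_eqVlt.
  have [<- _|_ /= ac] := eqVneq a c => cb bc; apply/seteqP;
      split=> y /=; rewrite !in_itv/= !andbT.
  - case=> -[].
      by move=> yab /not_orP[/negP]; rewrite -leNgt => ? _; left; right; lra.
    by move=> [yc|yc] nab; [left; left|right].
  - case=> [[ya|ycb]|yc].
    + by right; split; [left|move=> ?; lra].
    + by left; split; [lra|move=> [?|?]; lra].
    + by right; split; [right|move=> ?; lra].
  - case=> -[].
      by move=> yab /not_orP[/negP]; rewrite -leNgt => cy _; left; right; lra.
    move=> [yc|yc] nab; last by right.
    by left; left; rewrite leNgt; apply/negP => ay; apply: nab; lra.
  - case=> [[ya|ycb]|yc].
    + by right; split; [left; lra|move=> ?; lra].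
    + by left; split; [lra|move=> [?|?]; lra].
    + by right; split; [right|move=> ?; lra].
rewrite (mu_setU mu)//; last 2 first.
- by apply: measurableU.
- rewrite -subset0 => y /=; rewrite !itv_boundlr/= !bnd_simp.
  by rewrite /s; case: (a == c) => /=; rewrite ?bnd_simp => -[[]]; lra.
rewrite (mu_setU mu)//; last first.
  rewrite -subset0 => y /=; rewrite !itv_boundlr/= /s.
  by have [<-|ac'] := eqVneq a c; rewrite /= !bnd_simp; lra.
rewrite (mu_itvNy Fmu) (mu_itv Fmu)// (mu_itvy Fmu) -!EFinD Fa Fb Fc FNc.
by congr EFin; field.
Qed.

End Profile.

(** * Assembly: exact values, expansion, limits and two-sided bound *)

Theorem mainTheorem3 (R : realType) (mu : probability (measurableTypeR R) R)
    (f : R -> R) (Fmu : inF mu f)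
    (J2 : forall t : R, 0 < t < 1 / 2 ->
       derivable (J mu f) t 1 /\ derivable (derive1 (J mu f)) t 1) :
  [/\ (forall eps eta : R, 0 < eps < 1 / 2 -> 0 < eta < 1 / 2 ->
         2 * eta <= eps ->
         mu (Eset mu eps eta) = (1 / 2 - eta)%:E
         /\ asymmetry mu (Eset mu eps eta) = (1 - eps)%:E),
      (exists r1 r2 : R * R -> R,
         [/\ (forall eps eta : R, 0 < eps < 1 / 2 -> 0 < eta < 1 / 2 ->
                2 * eta <= eps ->
                deficit mu f (Eset mu eps eta) =
                  (2 * derive1 (J mu f) (1 / 4) * eta
                   + 1 / 4 * derive1n 2 (J mu f) (1 / 4) * eps ^+ 2
                   + r1 (eps, eta) + r2 (eps, eta))%:E),
             r1 =o_to0 (fun z : R * R => z.2 ^+ 2)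
           & r2 =o_to0 (fun z : R * R => z.1 ^+ 2)]),
      (deficit mu f (Eset mu z.1 z.2) @[z --> to0] --> 0%E
       /\ asymmetry mu (Eset mu z.1 z.2) @[z --> to0] --> 1%E)
    & (0 < derive1n 2 (J mu f) (1 / 4) ->
       exists C eps0 : R, [/\ 1 <= C, 0 < eps0 &
         forall eps eta : R, 0 < eps < 1 / 2 -> 0 < eta < 1 / 2 ->
           2 * eta <= eps -> eps <= eps0 ->
           let p := 1 / 2 - eta in
           let lambda := 1 - eps in
           ((C^-1 * ((1 - lambda) ^+ 2 + (1 - 2 * p)))%:E
              <= deficit mu f (Eset mu eps eta)
              <= (C * ((1 - lambda) ^+ 2 + (1 - 2 * p)))%:E)%E])].
Proof.
set J := J mu f in J2 *.
have [dJ d2J] : derivable J (1 / 4) 1 /\ derivable (derive1 J) (1 / 4) 1.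
  by apply: J2; lra.
have remP := deficit_remainder_le (fun t t0 => (J2 t t0).1) d2J.
have eps0 : z.1 @[z --> @to0 R] --> (0 : R).
  by apply: cvg_within_filter; exact: (@cvg_fst _ _ (nbhs (0 : R)) (nbhs (0 : R))).
have eta0 : z.2 @[z --> @to0 R] --> (0 : R).
  by apply: cvg_within_filter; exact: (@cvg_snd _ _ (nbhs (0 : R)) (nbhs (0 : R))).
have eps_near (d : R) : 0 < d -> \forall z \near @to0 R, z.1 < d.
  by move=> d0; exact: (cvgr_lt _ eps0 _ d0).
have adm_near : \forall z \near @to0 R, admissible z by exact: withinT.
split.
- move=> eps eta e1 e2 e3; have adm : admissible (eps, eta) by [].
  by rewrite (mu_Eset Fmu)// (asymmetry_Eset Fmu).
(* The whole error is put into the [o(eps^2)] term, since [eta <= eps / 2] on admissible pairs. *)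
- exists (fun=> 0), (deficit_remainder J); split.
  + move=> eps eta e1 e2 e3; have adm : admissible (eps, eta) by [].
    rewrite (deficit_Eset Fmu)//; congr EFin.
    by rewrite /deficit_remainder/= -/J; ring.
  + by apply/eqoP => c c0; near=> z; rewrite normr0 mulr_ge0// ltW.
  + apply/eqoP => c c0; have [d d0 dP] := remP c c0.
    near=> z; rewrite normrX [`|z.1|]ger0_norm.
      by apply: dP; [near: z|near: z; exact: eps_near].
    have : admissible z by near: z.
    by case=> /andP[/ltW].
(* For the limit of the deficit, continuity of [J] at 1/4 is enough: the limits of the three terms
   cancel. *)
- have J_cvg (u : R * R -> R) : u z @[z --> @to0 R] --> (0 : R) ->
      J (1 / 4 + u z) @[z --> @to0 R] --> J (1 / 4).
    move=> u0; have Jc : {for 1 / 4, continuous J}.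
      by apply: differentiable_continuous; apply/derivable1_diffP.
    apply: continuous_cvg; first exact: Jc.
    by rewrite -[X in _ --> X]addr0; apply: cvgD => //; exact: cvg_cst.
  have half0 (u : R * R -> R) : u z @[z --> @to0 R] --> (0 : R) ->
      u z / 2 @[z --> @to0 R] --> (0 : R).
    by move=> u0; rewrite -(mul0r (2^-1 : R)); apply: cvgMl.
  split.
  + have : (deficit_profile J z)%:E @[z --> @to0 R] --> 0%E.
      apply: cvg_EFin; first by near=> z.
      rewrite [X in _ --> X](_ : _ = J (1 / 4) + J (1 / 4) - 2 * J (1 / 4)); last by ring.
      apply: cvgB; [apply: cvgD|apply: cvgMr]; apply: J_cvg.
      * by apply: half0; rewrite -(subrr (0 : R)); exact: cvgB.
      * by apply: half0; rewrite -(addr0 (0 : R)); exact: cvgD.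
      * by rewrite -oppr0; apply: cvgN; exact: half0.
    apply: cvg_trans; apply: near_eq_cvg; near=> z.
    have admz : admissible (z.1, z.2) by rewrite -surjective_pairing; near: z.
    by rewrite (deficit_Eset Fmu admz) -surjective_pairing.
  + have : (1 - z.1)%:E @[z --> @to0 R] --> 1%E.
      apply: cvg_EFin; first by near=> z.
      by rewrite -[X in _ --> X]subr0; apply: cvgB => //; exact: cvg_cst.
    apply: cvg_trans; apply: near_eq_cvg; near=> z.
    have admz : admissible (z.1, z.2) by rewrite -surjective_pairing; near: z.
    by rewrite (asymmetry_Eset Fmu admz).
- move=> J''0.
  set a := derive1 J (1 / 4); set b := derive1n 2 J (1 / 4).
  have a0 : 0 < a by apply: (J_derive_gt0 Fmu) => //; lra.
  have b0 : 0 < b by [].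
  (* Half of the coefficient [b / 4]: the remainder leaves between [b / 8] and [3 / 8 * b] times
     [eps ^+ 2]. *)
  have b8 : 0 < b / 8 by rewrite divr_gt0.
  have [d d0 dP] := remP _ b8.
  (* The terms [a^-1] and [8 / b] serve the lower bound, [a] and [3 / 8 * b] the upper one, and 1
     gives [1 <= C]. *)
  pose C := 1 + a^-1 + 8 / b + a + 3 / 8 * b.
  have ai : 0 < a^-1 by rewrite invr_gt0.
  have bi : 0 < 8 / b by rewrite divr_gt0.
  have C1 : 1 <= C by rewrite /C; lra.
  (* The remainder bound asks for [eps < d] strictly, whereas [eps] may equal the threshold; hence
     the half. *)
  exists C, (d / 2); split => //; first by rewrite divr_gt0.
  move=> eps eta e1 e2 e3 epsd; cbv zeta.
  have adm : admissible (eps, eta) by [].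
  have := dP _ adm; rewrite /= ler_norml => /(_ ltac:(lra)) remle.
  rewrite (deficit_Eset Fmu)// !lee_fin.
  have -> : deficit_profile J (eps, eta) =
      2 * a * eta + b / 4 * eps ^+ 2 + deficit_remainder J (eps, eta).
    by rewrite /deficit_remainder -/a -/b/=; field.
  have -> : (1 - (1 - eps)) ^+ 2 + (1 - 2 * (1 / 2 - eta)) = eps ^+ 2 + 2 * eta.
    by field.
  have eps2 : 0 < eps ^+ 2 by rewrite exprn_gt0; lra.
  have Ca : C^-1 <= a by rewrite -(invrK a) lef_pV2 ?posrE//; rewrite /C; lra.
  have Cb : C^-1 <= b / 8 by rewrite -(invf_div 8 b) lef_pV2 ?posrE//; rewrite /C; lra.
  have l1 : C^-1 * eps ^+ 2 <= b / 8 * eps ^+ 2 by rewrite ler_pM2r.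
  have l2 : C^-1 * eta <= a * eta by rewrite ler_pM2r//; lra.
  have u1 : 3 / 8 * b * eps ^+ 2 <= C * eps ^+ 2.
    by rewrite ler_pM2r// /C; lra.
  have u2 : a * eta <= C * eta by rewrite ler_pM2r; [rewrite /C|]; lra.
  by lra.
Unshelve. all: by end_near.
Qed.
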